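(* Let $Q$ be a Hausdorff, connected, locally path-connected space. Let $G$ be a Lie group, $H\rightarrow Q$ be a $Q$-group, and $f:H\rightarrow G_Q$ be a morphism of $Q$-groups. Then $f$ is ubiquitous if and only if the induced group morphism $f_*:\hat{\pi}_0(H)\rightarrow \pi_0(G)$ is surjective.
   Context: A $Q$-space is a Hausdorff, locally path-connected space $X$ with a continuous map $X\to Q$, written $x\mapsto \|x\|$; morphisms of $Q$-spaces are continuous maps commuting with the maps to $Q$. A $Q$-group is a group object in $Q$-spaces: a $Q$-space $H$ with continuous maps over $Q$ (multiplication $m:H\times_Q H\to H$, unit $Q\to H$, inverse $H\to H$) making every fibre $H_q$ a group; morphisms of $Q$-groups are morphisms of $Q$-spaces that are fibrewise group morphisms. For a locally path-connected Hausdorff topological group $D$, $D_Q$ denotes the $Q$-group $D\times Q\to Q$ with fibrewise group law. Ubiquity: $f:H\to G_Q$ is ubiquitous if the quotient space $G_Q/H$ is connected, where $G_Q/H$ is the quotient of $G\times Q$ by the relation identifying two points $y,z$ iff they lie over the same point $q$ of $Q$ and $z=y\cdot f(h)$ for some $h\in H_q$. The group $\hat\pi_0(H)$: for $c_1,c_2\in\pi_0(H)$ let $c_1\cdot c_2$ be the set of connected components of $H$ that meet $m(c_1\times_Q c_2)$. Then $\hat\pi_0(H)$ is the discrete group with presentation $\langle \pi_0(H)\mid c_1c_2c_3^{-1}\ \text{for all } c_1,c_2 \text{ and all } c_3\in c_1\cdot c_2\rangle$. The functor $\hat\pi_0$ is left adjoint to the functor $D\mapsto D_Q$ from discrete groups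 to $Q$-groups. The morphism $f_*:\hat\pi_0(H)\to\pi_0(G)$ is the group morphism corresponding by adjunction to the composition $H\to G_Q\to \pi_0(G)_Q$ (equivalently, $\hat\pi_0(f)$ followed by the natural isomorphism $\hat\pi_0(G_Q)\cong\pi_0(G)$). *)

(* Defs.v *)
From HB Require Import structures.
From mathcomp Require Import all_boot all_order all_algebra.
From mathcomp Require Import all_classical all_reals all_analysis.

Set Implicit Arguments.
Unset Strict Implicit.
Unset Printing Implicit Defensive.

Import Order.TTheory GRing.Theory Num.Theory.
Import numFieldNormedType.Exports.

Local Open Scope classical_set_scope.
Local Open Scope quotient_scope.

Definition path_connected (R : realType) (X : topologicalType) (A : set X) :=
  forall x y, A x -> A y -> exists g : R -> X,
    [/\ {within `[0%R, 1%R], continuous g}, g 0%R = x, g 1%R = y &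
        g @` `[0%R, 1%R] `<=` A].

Definition locally_path_connected (R : realType) (X : topologicalType) :=
  forall (x : X) (U : set X), nbhs x U ->
    exists V, [/\ open_nbhs x V, V `<=` U & path_connected R V].

Lemma path_connectedX (R : realType) (X Y : topologicalType)
    (A : set X) (B : set Y) :
  path_connected R A -> path_connected R B -> path_connected R (A `*` B).
Proof.
move=> cA cB [x1 y1] [x2 y2] [/= Ax1 By1] [/= Ax2 By2].
have [g [cg g0 g1 gA]] := cA _ _ Ax1 Ax2.
have [h [ch h0 h1 hB]] := cB _ _ By1 By2.
exists (fun t => (g t, h t)); split; rewrite ?g0 ?g1 ?h0 ?h1 //.
  by move=> t; apply: cvg_pair; [exact: cg | exact: ch].
by move=> _ [t t01 <-]; split; [apply: gA | apply: hB]; exists t.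
Qed.

Lemma locally_path_connected_prod (R : realType) (X Y : topologicalType) :
  locally_path_connected R X -> locally_path_connected R Y ->
  locally_path_connected R (X * Y)%type.
Proof.
move=> lX lY [x y] U [[A B] [/= nA nB] AB].
have [V [oV VA cV]] := lX _ _ nA.
have [W [oW WB cW]] := lY _ _ nB.
exists (V `*` W); split.
- split; last by split; [case: oV | case: oW].
  rewrite openE => -[a b] [/= Va Wb]; exists (V, W) => //.
  by split => /=; [case: oV => o _ | case: oW => o _]; exact: open_nbhs_nbhs.
- by move=> [a b] [/= Va Wb]; apply: AB; split; [exact: VA | exact: WB].
- exact: path_connectedX.
Qed.

Lemma hausdorff_prod (X Y : topologicalType) :
  hausdorff_space X -> hausdorff_space Y -> hausdorff_space (X * Y)%type.
Proof.
move=> hX hY [x y] [x' y'] H; congr pair.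
- apply: hX => A B nA nB.
  have [||[a b] [[/= Aa _] [/= Bb _]]] := H (A `*` setT) (B `*` setT).
  + by exists (A, setT) => //; split => //=; exact: filterT.
  + by exists (B, setT) => //; split => //=; exact: filterT.
  by exists a.
- apply: hY => A B nA nB.
  have [||[a b] [[/= _ Aa] [/= _ Bb]]] := H (setT `*` A) (setT `*` B).
  + by exists (setT, A) => //; split => //=; exact: filterT.
  + by exists (setT, B) => //; split => //=; exact: filterT.
  by exists b.
Qed.

Section pi0.
Variable X : topologicalType.

Definition same_component (x y : X) : bool :=
  `[< connected_component [set: X] x y >].

Lemma same_component_refl : reflexive same_component.
Proof. by move=> x; apply/asboolP/connected_component_refl. Qed.

Lemma same_component_sym : symmetric same_component.
Proof.
by move=> x y; apply/asboolP/asboolP; exact: connected_component_sym.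
Qed.

Lemma same_component_trans : transitive same_component.
Proof.
move=> y x z /asboolP xy /asboolP yz; apply/asboolP.
exact: connected_component_trans xy yz.
Qed.

Canonical same_component_equiv := EquivRel same_component
  same_component_refl same_component_sym same_component_trans.

(** The set of connected components, with the discrete topology. *)
Definition pi0 := {eq_quot same_component}.

HB.instance Definition _ := Choice.on pi0.
HB.instance Definition _ := EqQuotient.on pi0.
HB.instance Definition _ := hasNbhs.Build pi0 principal_filter.
HB.instance Definition _ := Discrete_ofNbhs.Build pi0 erefl.

Definition component (x : X) : pi0 := \pi_pi0 x.

Lemma componentP (x y : X) :
  component x = component y <-> connected_component [set: X] x y.
Proof.
rewrite /component; split=> [/eqP|xy]; first by rewrite eqmodE => /asboolP.
by apply/eqP; rewrite eqmodE; apply/asboolP.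
Qed.

Lemma component_repr (c : pi0) : component (repr c) = c.
Proof. exact: reprK. Qed.

End pi0.

Lemma connected_component_image (X Y : topologicalType) (g : X -> Y) (x y : X) :
  continuous g -> connected_component [set: X] x y ->
  connected_component [set: Y] (g x) (g y).
Proof.
move=> cg [C [Cx _ cC] Cy]; exists (g @` C); last by exists y.
split=> [|//|]; first by exists x.
by apply: connected_continuous_connected => //; exact: continuous_subspaceT.
Qed.

Lemma lpc_component_open (R : realType) (X : topologicalType) (x : X) :
  locally_path_connected R X -> \forall y \near x, component y = component x.
Proof.
move=> lX; have [V [[oV Vx] _ pV]] := lX x setT filterT.
apply: filterS (open_nbhs_nbhs (conj oV Vx)) => y Vy; apply/componentP.
have [g [cg g0 g1 gV]] := pV _ _ Vy Vx.
exists (g @` `[0%R, 1%R]).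
  split=> [|//|]; first by exists 0%R => //=; rewrite in_itv /= lexx ler01.
  by apply: connected_continuous_connected => //; exact: segment_connected.
by exists 1%R => //=; rewrite in_itv /= lexx ler01.
Qed.

HB.mixin Record isTopGroup G & Topological G & Group G := {
  mulg_continuous : continuous (fun z : G * G => z.1 * z.2)%g;
  invg_continuous : continuous (fun x : G => x^-1)%g
}.

#[short(type="topGroupType")]
HB.structure Definition TopGroup := {G of Topological G & Group G & isTopGroup G}.

Section pi0_group.
Variable G : topGroupType.
Local Open Scope group_scope.

Lemma mulgl_continuous (y : G) : continuous (fun z : G => z * y).
Proof.
move=> z; have cz : {for z, continuous (fun z : G => (z, y))}.
  by apply: cvg_pair => //; exact: cvg_cst.
exact: (continuous_comp cz (mulg_continuous (z, y))).
Qed.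

Lemma mulgr_continuous (x : G) : continuous (fun z : G => x * z).
Proof.
move=> z; have cz : {for z, continuous (fun z : G => (x, z))}.
  by apply: cvg_pair => //; exact: cvg_cst.
exact: (continuous_comp cz (mulg_continuous (x, z))).
Qed.

Lemma component_mul (x x' y y' : G) : component x = component x' ->
  component y = component y' -> component (x * y) = component (x' * y').
Proof.
move=> /componentP xx' /componentP yy'; apply/componentP.
have H1 := connected_component_image (@mulgl_continuous y) xx'.
exact: connected_component_trans H1
  (connected_component_image (@mulgr_continuous x') yy').
Qed.

Lemma component_inv (x x' : G) :
  component x = component x' -> component x^-1 = component x'^-1.
Proof.
move=> /componentP xx'; apply/componentP.
exact: (connected_component_image (@invg_continuous G) xx').
Qed.

Definition pi0_mul (c d : pi0 G) : pi0 G := component (repr c * repr d).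
Definition pi0_inv (c : pi0 G) : pi0 G := component (repr c)^-1.
Definition pi0_one : pi0 G := component 1.

Lemma pi0_mulE (x y : G) :
  pi0_mul (component x) (component y) = component (x * y).
Proof. by apply: component_mul; exact: component_repr. Qed.

Lemma pi0_invE (x : G) : pi0_inv (component x) = component x^-1.
Proof. by apply: component_inv; exact: component_repr. Qed.

Lemma pi0_mulA : associative pi0_mul.
Proof.
move=> a b c; rewrite -[a]component_repr -[b]component_repr -[c]component_repr.
by rewrite !pi0_mulE mulgA.
Qed.

Lemma pi0_mul1 : left_id pi0_one pi0_mul.
Proof. by move=> a; rewrite -[a]component_repr pi0_mulE mul1g. Qed.

Lemma pi0_1mul : right_id pi0_one pi0_mul.
Proof. by move=> a; rewrite -[a]component_repr pi0_mulE mulg1. Qed.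

Lemma pi0_mulV : left_inverse pi0_one pi0_inv pi0_mul.
Proof. by move=> a; rewrite -[a]component_repr pi0_invE pi0_mulE mulVg. Qed.

Lemma pi0_Vmul : right_inverse pi0_one pi0_inv pi0_mul.
Proof. by move=> a; rewrite -[a]component_repr pi0_invE pi0_mulE mulgV. Qed.

HB.instance Definition _ := isGroup.Build (pi0 G)
  pi0_mulA pi0_mul1 pi0_1mul pi0_mulV pi0_Vmul.

Lemma componentM (x y : G) : component (x * y) = component x * component y.
Proof. by rewrite -pi0_mulE. Qed.

End pi0_group.

Lemma discrete_prod_continuous (X Y : discreteTopologicalType)
  (Z : topologicalType) (g : X * Y -> Z) : continuous g.
Proof.
move=> [x y] U /nbhs_singleton Ug; exists ([set x], [set y]).
  by split; exact: discrete_set1.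
by move=> [a b] [/= -> ->].
Qed.

Lemma discrete_continuous (X : discreteTopologicalType)
  (Z : topologicalType) (g : X -> Z) : continuous g.
Proof.
move=> x U /nbhs_singleton Ug; apply: filterS (discrete_set1 x).
by move=> _ ->.
Qed.

HB.instance Definition _ (G : topGroupType) := isTopGroup.Build (pi0 G)
  (@discrete_prod_continuous (pi0 G) (pi0 G) _ _)
  (@discrete_continuous (pi0 G) _ _).


#[short(type="discreteGroupType")]
HB.structure Definition DiscreteGroup :=
  {G of TopGroup G & DiscreteTopology G}.

HB.instance Definition _ (G : topGroupType) := TopGroup.on (pi0 G).

Lemma discrete_component (D : discreteTopologicalType) (x y : D) :
  connected_component [set: D] x y -> x = y.
Proof.
move=> [C [Cx _ cC] Cy].
have xC : [set x] = C.
  apply: cC; first by exists x.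
  - exists [set x]; first exact: discrete_open.
    by apply/seteqP; split=> [_ ->|_ [_ ->]].
  - exists [set x]; first exact: discrete_closed.
    by apply/seteqP; split=> [_ ->|_ [_ ->]].
by move: Cy; rewrite -xC.
Qed.

Lemma discrete_hausdorff (D : discreteTopologicalType) : hausdorff_space D.
Proof.
move=> x y /(_ _ _ (discrete_set1 x) (discrete_set1 y)).
by move=> [_ [-> ->]].
Qed.

Lemma discrete_lpc (R : realType) (D : discreteTopologicalType) :
  locally_path_connected R D.
Proof.
move=> x U /nbhs_singleton Ux; exists [set x]; split.
- by split=> //; exact: discrete_open.
- by move=> _ ->.
- move=> _ _ -> ->; exists (fun=> x); split=> //.
    by apply: continuous_subspaceT => ?; exact: cvg_cst.
  by move=> _ [t _ <-].
Qed.

Lemma component_continuous (R : realType) (X : topologicalType) :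
  locally_path_connected R X -> continuous (@component X).
Proof.
move=> lX x U /nbhs_singleton Ux.
by apply: filterS (lpc_component_open x lX) => y yx; rewrite /preimage /= yx.
Qed.

(** All the iterated partial derivatives of [f] of order at most
    [k] exist and are continuous at every point of the open set [U]. *)
Fixpoint Ck (R : realType) (n m k : nat) (U : set 'rV[R]_n)
    (f : 'rV[R]_n -> 'rV[R]_m) : Prop :=
  (forall x, U x -> {for x, continuous f}) /\
  match k with
  | 0%N => True
  | k'.+1 => forall i : 'I_n,
      (forall x, U x -> derivable f x (delta_mx 0%R i)) /\
      Ck k' U (fun x => 'D_(delta_mx 0%R i) f x)
  end.

Definition smooth_on (R : realType) (n m : nat) (U : set 'rV[R]_n)
  (f : 'rV[R]_n -> 'rV[R]_m) := forall k, Ck k U f.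

Record chart (R : realType) (X : topologicalType) (n : nat) := Chart {
  chart_dom : set X;
  chart_cod : set 'rV[R]_n;
  chart_map : X -> 'rV[R]_n;
  chart_inv : 'rV[R]_n -> X;
  chart_dom_open : open chart_dom;
  chart_cod_open : open chart_cod;
  chart_map_cod : forall x, chart_dom x -> chart_cod (chart_map x);
  chart_inv_dom : forall u, chart_cod u -> chart_dom (chart_inv u);
  chart_mapK : forall x, chart_dom x -> chart_inv (chart_map x) = x;
  chart_invK : forall u, chart_cod u -> chart_map (chart_inv u) = u;
  chart_map_cont : forall x, chart_dom x -> {for x, continuous chart_map};
  chart_inv_cont : forall u, chart_cod u -> {for u, continuous chart_inv}
}.

(** Second countability is not required, so that every discrete group is a
    Lie group of dimension [0]. *)
Record lieGroup (R : realType) := LieGroup {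
  lie_sort :> topGroupType;
  lie_hausdorff : hausdorff_space lie_sort;
  lie_dim : nat;
  lie_atlas : set (chart R lie_sort lie_dim);
  lie_cover : forall x, exists2 a, lie_atlas a & chart_dom a x;
  lie_compat : forall a b, lie_atlas a -> lie_atlas b ->
    smooth_on [set u | chart_cod a u /\ chart_dom b (chart_inv a u)]
      (fun u => chart_map b (chart_inv a u));
  lie_mul_smooth : forall a b c, lie_atlas a -> lie_atlas b -> lie_atlas c ->
    smooth_on
      [set w : 'rV[R]_(lie_dim + lie_dim) |
        [/\ chart_cod a (lsubmx w), chart_cod b (rsubmx w) &
            chart_dom c (chart_inv a (lsubmx w) * chart_inv b (rsubmx w))%g]]
      (fun w => chart_map c
        (chart_inv a (lsubmx w) * chart_inv b (rsubmx w))%g);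
  lie_inv_smooth : forall a b, lie_atlas a -> lie_atlas b ->
    smooth_on [set u | chart_cod a u /\ chart_dom b (chart_inv a u)^-1%g]
      (fun u => chart_map b (chart_inv a u)^-1%g)
}.

Lemma chart_lpc (R : realType) (X : topologicalType) (n : nat) :
  (forall x : X, exists a : chart R X n, chart_dom a x) ->
  locally_path_connected R X.
Proof.
move=> cX x U nU; have [a ax] := cX x.
have ainv : chart_inv a @ chart_map a x --> x.
  by rewrite -[X in _ --> X](chart_mapK ax); exact/chart_inv_cont/chart_map_cod.
have : \forall u \near chart_map a x, chart_cod a u /\ U (chart_inv a u).
  apply: filterI; last exact: ainv.
  apply: open_nbhs_nbhs; split; first exact: chart_cod_open.
  exact: chart_map_cod.
move=> /nbhs_ballP[e /= e0 eU].
pose B := ball (chart_map a x) e.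
exists (chart_dom a `&` chart_map a @^-1` B); split.
- split; last by split=> //; exact: ballxx.
  rewrite openE => y [ay By]; apply: filterI.
    by apply: open_nbhs_nbhs; split=> //; exact: chart_dom_open.
  apply: (chart_map_cont ay); apply: open_nbhs_nbhs; split=> //.
  exact: ball_open.
- by move=> y [ay /eU[_]]; rewrite chart_mapK.
- move=> y z [ay By] [az Bz].
  pose p (t : R) := ((1 - t) *: chart_map a y + t *: chart_map a z)%R.
  have pB t : `[0%R, 1%R]%classic t -> B (p t).
    rewrite /= in_itv /= => /andP[t0 t1].
    move: By Bz; rewrite /B -ball_normE /= => By Bz.
    have -> : (chart_map a x - p t = (1 - t) *: (chart_map a x - chart_map a y)
        + t *: (chart_map a x - chart_map a z))%R.
      rewrite /p !scalerBr addrACA -scalerDl subrK scale1r opprD.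
      by [].
    rewrite (le_lt_trans (ler_normD _ _))// !normrZ.
    rewrite (ger0_norm t0) ger0_norm ?subr_ge0//.
    have [->|tn0] := eqVneq t 0%R; first by rewrite subr0 mul1r mul0r addr0.
    have -> : e = ((1 - t) * e + t * e)%R by rewrite -mulrDl subrK mul1r.
    apply: ler_ltD; first by rewrite ler_wpM2l ?subr_ge0// ltW.
    by rewrite ltr_pM2l// lt_def tn0.
  exists (chart_inv a \o p); split.
  + apply/subspace_continuousP => t t01; apply: cvg_within_filter.
    apply: continuous_comp; last by apply: chart_inv_cont; case: (eU _ (pB _ t01)).
    apply: cvgD; apply: cvgZr_tmp => //.
    by apply: cvgB => //; exact: cvg_cst.
  + by rewrite /= /p subr0 scale1r scale0r addr0 chart_mapK.
  + by rewrite /= /p subrr scale1r scale0r add0r chart_mapK.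
  + move=> _ [t t01 <-] /=; have Bt := pB _ t01; have [ct Ut] := eU _ Bt.
    by split; [exact: chart_inv_dom | rewrite /= chart_invK].
Qed.

Lemma lie_lpc (R : realType) (G : lieGroup R) : locally_path_connected R G.
Proof. by apply: chart_lpc => x; have [a _ ax] := lie_cover x; exists a. Qed.

Record qspace (R : realType) (Q : topologicalType) := QSpace {
  qs_sort :> topologicalType;
  qs_hausdorff : hausdorff_space qs_sort;
  qs_lpc : locally_path_connected R qs_sort;
  qnorm : qs_sort -> Q;
  qnorm_cont : continuous qnorm
}.
Arguments qnorm {R Q q}.

(** The fibred product over [Q]. As a type it is a [set_type], which carries
    the topology induced by the product. *)
Definition fibprod (R : realType) (Q : topologicalType) (X Y : qspace R Q) :
  set (X * Y) := [set z | qnorm z.1 = qnorm z.2].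
Arguments fibprod {R Q} X Y _.

Definition fpair (R : realType) (Q : topologicalType) (X Y : qspace R Q)
    (x : X) (y : Y) (e : qnorm x = qnorm y) : fibprod X Y :=
  exist _ (x, y) (mem_set e).

(** In the axioms the side conditions [e] of [fpair] are universally
    quantified; they hold by [qmulP], [qoneP], [qinvP], and do not matter by
    proof irrelevance. *)
Record qgroup (R : realType) (Q : topologicalType) := QGroup {
  qg_space :> qspace R Q;
  qmul : fibprod qg_space qg_space -> qg_space;
  qone : Q -> qg_space;
  qinv : qg_space -> qg_space;
  qmul_cont : continuous qmul;
  qone_cont : continuous qone;
  qinv_cont : continuous qinv;
  qmulP : forall x y (e : qnorm x = qnorm y), qnorm (qmul (fpair e)) = qnorm x;
  qoneP : forall q, qnorm (qone q) = q;
  qinvP : forall x, qnorm (qinv x) = qnorm x;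
  qmulA : forall x y z (xy : qnorm x = qnorm y) (yz : qnorm y = qnorm z)
    (e1 : qnorm x = qnorm (qmul (fpair yz)))
    (e2 : qnorm (qmul (fpair xy)) = qnorm z),
    qmul (fpair e1) = qmul (fpair e2);
  qmul1l : forall x (e : qnorm (qone (qnorm x)) = qnorm x), qmul (fpair e) = x;
  qmul1r : forall x (e : qnorm x = qnorm (qone (qnorm x))), qmul (fpair e) = x;
  qmulVl : forall x (e : qnorm (qinv x) = qnorm x),
    qmul (fpair e) = qone (qnorm x);
  qmulVr : forall x (e : qnorm x = qnorm (qinv x)),
    qmul (fpair e) = qone (qnorm x)
}.

Record qmorphism (R : realType) (Q : topologicalType) (H K : qgroup R Q) :=
  QMorphism {
  qfun :> H -> K;
  qfun_cont : continuous qfun;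
  qfunP : forall x, qnorm (qfun x) = qnorm x;
  qfunM : forall x y (e : qnorm x = qnorm y)
    (e' : qnorm (qfun x) = qnorm (qfun y)),
    qfun (qmul (fpair e)) = qmul (fpair e')
}.

Section qcomp.
Variables (R : realType) (Q : topologicalType) (H K L : qgroup R Q).
Variables (g : qmorphism K L) (f : qmorphism H K).

Lemma qcomp_cont : continuous (g \o f).
Proof. by move=> x; apply: continuous_comp; exact: qfun_cont. Qed.

Lemma qcompP x : qnorm ((g \o f) x) = qnorm x.
Proof. by rewrite /= !qfunP. Qed.

Lemma qcompM x y (e : qnorm x = qnorm y)
    (e' : qnorm ((g \o f) x) = qnorm ((g \o f) y)) :
  (g \o f) (qmul (fpair e)) = qmul (fpair e').
Proof.
have e1 : qnorm (f x) = qnorm (f y) by rewrite !qfunP.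
by rewrite /= (qfunM e e1) (qfunM e1 e').
Qed.

Definition qcomp : qmorphism H L := QMorphism qcomp_cont qcompP qcompM.

End qcomp.

(** [const_qgroup] is the Q-group [D_Q]. *)
Section constant_qgroup.
Variables (R : realType) (Q : topologicalType).
Hypotheses (hQ : hausdorff_space Q) (lQ : locally_path_connected R Q).

Section object.
Variable D : topGroupType.
Hypotheses (hD : hausdorff_space D) (lD : locally_path_connected R D).

Lemma snd_continuous (X Y : topologicalType) : continuous (@snd X Y).
Proof. by move=> x; exact: cvg_snd. Qed.

Lemma fst_continuous (X Y : topologicalType) : continuous (@fst X Y).
Proof. by move=> x; exact: cvg_fst. Qed.

Definition const_qspace : qspace R Q :=
  QSpace (hausdorff_prod hD hQ) (locally_path_connected_prod lD lQ)
    (@snd_continuous D Q).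

Definition const_mul (z : fibprod const_qspace const_qspace) : const_qspace :=
  (((set_val z).1.1 * (set_val z).2.1)%g, (set_val z).1.2).

Definition const_one (q : Q) : const_qspace := (1%g, q).

Definition const_inv (x : const_qspace) : const_qspace := (x.1^-1%g, x.2).

Lemma const_mul_cont : continuous const_mul.
Proof.
have cval : continuous (set_val : fibprod const_qspace const_qspace -> _).
  exact: initial_continuous.
have c1 : continuous (fun z : (D * Q) * (D * Q) => (z.1.1, z.2.1)).
  move=> z; apply: cvg_pair.
    by apply: (continuous_comp (f := fst) (g := fst)); exact: cvg_fst.
  by apply: (continuous_comp (f := snd) (g := fst)); [exact: cvg_snd | exact: cvg_fst].
have c2 : continuous (fun z : (D * Q) * (D * Q) => ((z.1.1 * z.2.1)%g, z.1.2)).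
  move=> z; apply: cvg_pair.
    exact: (continuous_comp (c1 z) (mulg_continuous _)).
  by apply: (continuous_comp (f := fst) (g := snd)); [exact: cvg_fst | exact: cvg_snd].
by move=> z; exact: (continuous_comp (cval z) (c2 _)).
Qed.

Lemma const_one_cont : continuous const_one.
Proof. by move=> q; apply: cvg_pair => //; exact: cvg_cst. Qed.

Lemma const_inv_cont : continuous const_inv.
Proof.
move=> x; apply: cvg_pair; last exact: cvg_snd.
exact: (continuous_comp (@fst_continuous D Q x) (invg_continuous _)).
Qed.

Definition const_qgroup : qgroup R Q.
Proof.
apply: (QGroup const_mul_cont const_one_cont const_inv_cont) => //.
- move=> x y z xy yz e1 e2.
  by congr pair; rewrite /= mulgA.
- by move=> [d q] e; congr pair; rewrite /= mul1g.
- by move=> [d q] e; congr pair; rewrite /= mulg1.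
- by move=> [d q] e; congr pair; rewrite /= mulVg.
- by move=> [d q] e; congr pair; rewrite /= mulgV.
Defined.

End object.

Section morphism.
Variables D E : topGroupType.
Hypotheses (hD : hausdorff_space D) (lD : locally_path_connected R D).
Hypotheses (hE : hausdorff_space E) (lE : locally_path_connected R E).
Variable u : D -> E.
Hypotheses (cu : continuous u) (uM : {morph u : x y / (x * y)%g}).

Definition const_fun (x : const_qgroup hD lD) : const_qgroup hE lE :=
  (u x.1, x.2).

Lemma const_fun_cont : continuous const_fun.
Proof.
suff : continuous (fun x : D * Q => (u x.1, x.2)) by [].
have c1 : continuous (u \o (@fst D Q)).
  by move=> x; apply: continuous_comp; [exact: fst_continuous | exact: cu].
by move=> x; apply: cvg_pair; [exact: c1 | exact: cvg_snd].
Qed.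

Definition const_qmorphism :
  qmorphism (const_qgroup hD lD) (const_qgroup hE lE).
Proof.
apply: (QMorphism const_fun_cont) => // x y e e'.
by congr pair; rewrite /= uM.
Defined.

End morphism.
End constant_qgroup.

Section presentation.
Variables (S : choiceType).

(** The letter [(s, false)] is the generator [s]; [(s, true)] is its inverse. *)
Definition word := seq (S * bool).

Variable rel : set word.

Inductive word_cong : word -> word -> Prop :=
| word_refl w : word_cong w w
| word_sym w w' : word_cong w w' -> word_cong w' w
| word_trans w w' w'' : word_cong w w' -> word_cong w' w'' -> word_cong w w''
| word_cat u u' v v' : word_cong u u' -> word_cong v v' ->
    word_cong (u ++ v) (u' ++ v')
| word_cancel s b : word_cong [:: (s, b); (s, ~~ b)] [::]
| word_relator r : rel r -> word_cong r [::].

Definition word_eqv (w w' : word) : bool := `[< word_cong w w' >].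

Lemma word_eqv_refl : reflexive word_eqv.
Proof. by move=> w; apply/asboolP; exact: word_refl. Qed.

Lemma word_eqv_sym : symmetric word_eqv.
Proof. by move=> w w'; apply/asboolP/asboolP; exact: word_sym. Qed.

Lemma word_eqv_trans : transitive word_eqv.
Proof.
move=> w' w w'' /asboolP h /asboolP h'; apply/asboolP; exact: word_trans h h'.
Qed.

Canonical word_equiv := EquivRel word_eqv
  word_eqv_refl word_eqv_sym word_eqv_trans.

Definition presented := {eq_quot word_eqv}.

HB.instance Definition _ := Choice.on presented.
HB.instance Definition _ := EqQuotient.on presented.

Definition pres_class (w : word) : presented := \pi_presented w.

Definition generator (s : S) : presented := pres_class [:: (s, false)].

Lemma pres_classP (w w' : word) :
  pres_class w = pres_class w' <-> word_cong w w'.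
Proof.
rewrite /pres_class; split=> [/eqP|ww]; first by rewrite eqmodE => /asboolP.
by apply/eqP; rewrite eqmodE; apply/asboolP.
Qed.

Lemma pres_class_repr (c : presented) : pres_class (repr c) = c.
Proof. exact: reprK. Qed.

Definition word_inv (w : word) : word := rev [seq (a.1, ~~ a.2) | a <- w].

Lemma word_inv_cat u v : word_inv (u ++ v) = word_inv v ++ word_inv u.
Proof. by rewrite /word_inv map_cat rev_cat. Qed.

Lemma word_invK : involutive word_inv.
Proof.
move=> w; rewrite /word_inv map_rev revK -map_comp map_id_in// => -[s b] _.
by rewrite /= negbK.
Qed.

Lemma word_mulV w : word_cong (w ++ word_inv w) [::].
Proof.
elim: w => [|[s b] w IH]; first exact: word_refl.
apply: (word_trans (w' := [:: (s, b)] ++ ([::] ++ [:: (s, ~~ b)]))).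
  rewrite -cat1s word_inv_cat -catA; apply: word_cat; first exact: word_refl.
  by rewrite catA; apply: word_cat => //; exact: word_refl.
exact: word_cancel.
Qed.

Lemma word_Vmul w : word_cong (word_inv w ++ w) [::].
Proof. by have := word_mulV (word_inv w); rewrite word_invK. Qed.

Lemma word_inv_cong u v : word_cong u v -> word_cong (word_inv u) (word_inv v).
Proof.
move=> uv.
apply: (word_trans (w' := word_inv u ++ (v ++ word_inv v))).
  rewrite -[X in word_cong X]cats0; apply: word_cat; first exact: word_refl.
  exact/word_sym/word_mulV.
rewrite -[X in word_cong _ X]cat0s catA.
apply: word_cat; last exact: word_refl.
apply: (word_trans (w' := word_inv u ++ u)); last exact: word_Vmul.
by apply: word_cat; [exact: word_refl | exact: word_sym].
Qed.

Definition pres_mul (c d : presented) : presented :=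
  pres_class (repr c ++ repr d).
Definition pres_inv (c : presented) : presented := pres_class (word_inv (repr c)).
Definition pres_one : presented := pres_class [::].

Lemma pres_mulE u v :
  pres_mul (pres_class u) (pres_class v) = pres_class (u ++ v).
Proof.
by apply/pres_classP; apply: word_cat; apply/pres_classP; exact: pres_class_repr.
Qed.

Lemma pres_invE u : pres_inv (pres_class u) = pres_class (word_inv u).
Proof.
apply/pres_classP; apply: word_inv_cong; apply/pres_classP.
exact: pres_class_repr.
Qed.

Lemma pres_mulA : associative pres_mul.
Proof.
move=> a b c; rewrite -[a]pres_class_repr -[b]pres_class_repr.
by rewrite -[c]pres_class_repr !pres_mulE catA.
Qed.

Lemma pres_mul1 : left_id pres_one pres_mul.
Proof. by move=> a; rewrite -[a]pres_class_repr pres_mulE. Qed.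

Lemma pres_1mul : right_id pres_one pres_mul.
Proof. by move=> a; rewrite -[a]pres_class_repr pres_mulE cats0. Qed.

Lemma pres_mulV : left_inverse pres_one pres_inv pres_mul.
Proof.
move=> a; rewrite -[a]pres_class_repr pres_invE pres_mulE.
exact/pres_classP/word_Vmul.
Qed.

Lemma pres_Vmul : right_inverse pres_one pres_inv pres_mul.
Proof.
move=> a; rewrite -[a]pres_class_repr pres_invE pres_mulE.
exact/pres_classP/word_mulV.
Qed.

HB.instance Definition _ := isGroup.Build presented
  pres_mulA pres_mul1 pres_1mul pres_mulV pres_Vmul.

Section lift.
Variables (D : groupType) (g : S -> D).

Definition eval_word (w : word) : D :=
  foldr (fun a d => ((if a.2 then (g a.1)^-1 else g a.1) * d)%g) 1%g w.

Lemma eval_word_cat u v : eval_word (u ++ v) = (eval_word u * eval_word v)%g.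
Proof.
elim: u => [|a u IH] /=; first by rewrite mul1g.
by rewrite -/(eval_word _) IH mulgA.
Qed.

Hypothesis grel : forall r, rel r -> eval_word r = 1%g.

Lemma eval_word_cong u v : word_cong u v -> eval_word u = eval_word v.
Proof.
elim=> //.
- by move=> ? ? ? _ -> _ ->.
- by move=> ? ? ? ? _ e _ e'; rewrite !eval_word_cat e e'.
- by move=> s [] /=; rewrite mulg1 ?mulVg ?mulgV.
Qed.

Definition pres_lift (c : presented) : D := eval_word (repr c).

Lemma pres_liftE w : pres_lift (pres_class w) = eval_word w.
Proof. by apply/eval_word_cong/pres_classP; exact: pres_class_repr. Qed.

Lemma pres_lift_morphism : monoid.monoid_morphism pres_lift.
Proof.
split; first exact: pres_liftE.
move=> a b; rewrite -[a]pres_class_repr -[b]pres_class_repr.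
by rewrite [(_ * _)%g]pres_mulE !pres_liftE eval_word_cat.
Qed.

Definition pres_hom : UMagmaMorphism.type presented D :=
  HB.pack pres_lift (isUMagmaMorphism.Build _ _ pres_lift pres_lift_morphism).

End lift.
End presentation.

Section hatpi0.
Variables (R : realType) (Q : topologicalType) (H : qgroup R Q).

(** [comp_mul c1 c2] is the set, written [c1 . c2], of the components of [H]
    that meet [m(c1 x_Q c2)]. *)
Definition comp_mul (c1 c2 : pi0 H) : set (pi0 H) :=
  [set c3 | exists x y (e : qnorm x = qnorm y),
    [/\ component x = c1, component y = c2 & component (qmul (fpair e)) = c3]].

Definition hatpi0_rel : set (word (pi0 H)) :=
  [set w | exists c1 c2 c3, comp_mul c1 c2 c3 /\
    w = [:: (c1, false); (c2, false); (c3, true)]].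

Definition hatpi0 := presented hatpi0_rel.

HB.instance Definition _ := monoid.Group.on hatpi0.

(** A morphism of Q-groups from [H] to [D_Q], with [D] discrete, has a
    [D]-component which is constant on every connected component of [H]; it so
    defines the images in [D] of the generators of [hatpi0 H]. Lemmas
    [hatpi0_adjE] and [hatpi0_adj_unique] characterize the adjoint morphism. *)
Section adjunction.
Variables (hQ : hausdorff_space Q) (lQ : locally_path_connected R Q).
Variable D : discreteGroupType.

Definition discrete_qgroup : qgroup R Q :=
  const_qgroup hQ lQ (@discrete_hausdorff D) (@discrete_lpc R D).

Variable phi : qmorphism H discrete_qgroup.

Definition adj_gen (c : pi0 H) : D := (phi (repr c)).1.

Lemma adj_genE x : adj_gen (component x) = (phi x).1.
Proof.
apply: discrete_component.
have : connected_component [set: H] (repr (component x)) x.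
  exact/componentP/component_repr.
have c0 : continuous (phi : H -> (D * Q)%type) := @qfun_cont _ _ _ _ phi.
have cphi : continuous ((@fst D Q) \o (phi : H -> (D * Q)%type)).
  by move=> y; apply: continuous_comp; [exact: c0 | exact: fst_continuous].
exact: (connected_component_image cphi).
Qed.

Lemma adj_gen_rel r : hatpi0_rel r -> eval_word adj_gen r = 1%g.
Proof.
move=> [_ [_ [_ [[x [y [e [<- <- <-]]]] ->]]]] /=; rewrite !adj_genE mulg1.
have e' : qnorm (phi x) = qnorm (phi y) by rewrite !qfunP.
by rewrite (qfunM e e') /= mulgA mulgV.
Qed.

Definition hatpi0_adj : UMagmaMorphism.type hatpi0 D := pres_hom adj_gen_rel.

Lemma hatpi0_adjE x : hatpi0_adj (generator _ (component x)) = (phi x).1.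
Proof. by rewrite /= pres_liftE ?adj_genE /= ?mulg1 ?adj_genE//; exact: adj_gen_rel. Qed.

Lemma hatpi0_adj_unique (psi : UMagmaMorphism.type hatpi0 D) :
  (forall x, psi (generator _ (component x)) = (phi x).1) -> psi =1 hatpi0_adj.
Proof.
move=> psiE c; rewrite -[c]pres_class_repr.
elim: (repr c) => [|[s b] w IH]; first by rewrite !gmulf1.
have -> : pres_class hatpi0_rel ((s, b) :: w) =
    (pres_class hatpi0_rel [:: (s, b)] * pres_class hatpi0_rel w)%g.
  by rewrite [RHS]pres_mulE.
rewrite !gmulfM IH; congr (_ * _)%g.
have gE : psi (generator _ s) = hatpi0_adj (generator _ s).
  by rewrite -[s]component_repr psiE hatpi0_adjE.
case: b => //.
have -> : pres_class hatpi0_rel [:: (s, true)] = (generator hatpi0_rel s)^-1%g.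
  by rewrite [RHS]pres_invE.
by rewrite !gmulfV gE.
Qed.

End adjunction.
End hatpi0.

Section ubiquity.
Variables (R : realType) (Q : topologicalType).
Variables (hQ : hausdorff_space Q) (lQ : locally_path_connected R Q).
Variable (G : lieGroup R).

Definition lie_qgroup : qgroup R Q :=
  const_qgroup hQ lQ (@lie_hausdorff R G) (lie_lpc (G := G)).

Definition lie_component_qmorphism :
    qmorphism lie_qgroup (discrete_qgroup hQ lQ (pi0 G)) :=
  const_qmorphism hQ lQ (@lie_hausdorff R G) (lie_lpc (G := G))
    (@discrete_hausdorff _) (@discrete_lpc R _)
    (component_continuous (lie_lpc (G := G))) (@componentM G).

Variables (H : qgroup R Q) (f : qmorphism H lie_qgroup).

(** [f_*], the adjoint of [H -> G_Q -> pi0(G)_Q]. *)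
Definition hatpi0_map : UMagmaMorphism.type (hatpi0 H) (pi0 G) :=
  hatpi0_adj (qcomp lie_component_qmorphism f).

Lemma hatpi0_mapE x :
  hatpi0_map (generator _ (component x)) = component (f x).1.
Proof. exact: hatpi0_adjE. Qed.

Definition orbit_rel (y z : lie_qgroup) : Prop :=
  qnorm y = qnorm z /\
  exists (h : H) (e : qnorm y = qnorm (f h)), z = qmul (fpair e).

Definition orbit_eqv (y z : lie_qgroup) : bool := `[< orbit_rel y z >].

Lemma orbit_relE y z : orbit_rel y z <->
  exists h : H, [/\ qnorm h = y.2, z.2 = y.2 & z.1 = (y.1 * (f h).1)%g].
Proof.
split=> [[yz [h [e zE]]]|[h [hy zy zE]]].
  by exists h; split; [rewrite -(qfunP f) -e | rewrite zE | rewrite zE].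
split; first exact/esym.
have e : qnorm y = qnorm (f h) by rewrite qfunP hy.
by exists h, e; move: z zy zE => [a b] /= -> ->.
Qed.

Lemma fone q : (f (qone H q)).1 = 1%g.
Proof.
have e : qnorm (qone H (qnorm (qone H q))) = qnorm (qone H q) by rewrite !qoneP.
have e' : qnorm (f (qone H (qnorm (qone H q)))) = qnorm (f (qone H q)).
  by rewrite !qfunP.
have := congr1 fst (qfunM e e'); rewrite qmul1l /= qoneP => /esym.
by move=> ff; apply: (mulgI (f (qone H q)).1); rewrite mulg1.
Qed.

Lemma finv h : (f (qinv h)).1 = (f h).1^-1%g.
Proof.
have e : qnorm h = qnorm (qinv h) by rewrite qinvP.
have e' : qnorm (f h) = qnorm (f (qinv h)) by rewrite !qfunP.
have := congr1 fst (qfunM e e'); rewrite qmulVr fone /= => /esym ff.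
by apply: (mulgI (f h).1); rewrite mulgV.
Qed.

Lemma orbit_eqv_refl : reflexive orbit_eqv.
Proof.
move=> y; apply/asboolP/orbit_relE; exists (qone H y.2).
by rewrite qoneP fone mulg1.
Qed.

Lemma orbit_eqv_sym : symmetric orbit_eqv.
Proof.
suff s y z : orbit_rel y z -> orbit_rel z y.
  by move=> y z; apply/asboolP/asboolP; exact: s.
move=> /orbit_relE[h [hy zy zE]]; apply/orbit_relE; exists (qinv h).
by rewrite qinvP hy zy zE finv -mulgA mulgV mulg1.
Qed.

Lemma orbit_eqv_trans : transitive orbit_eqv.
Proof.
move=> y x z /asboolP/orbit_relE[h [hx yx yE]].
move=> /asboolP/orbit_relE[k [ky zy zE]]; apply/asboolP/orbit_relE.
have e : qnorm h = qnorm k by rewrite hx ky yx.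
have e' : qnorm (f h) = qnorm (f k) by rewrite !qfunP.
exists (qmul (fpair e)); rewrite qmulP hx zy yx (qfunM e e') zE yE /=.
by rewrite mulgA.
Qed.

Canonical orbit_equiv := EquivRel orbit_eqv
  orbit_eqv_refl orbit_eqv_sym orbit_eqv_trans.

(** [G_Q/H] *)
Definition orbit_space := quotient_topology {eq_quot orbit_eqv}.

Definition ubiquitous := connected [set: orbit_space].

End ubiquity.

(* Main.v *)
Require Import Defs.
From mathcomp Require Import all_boot all_order all_algebra.
From mathcomp Require Import all_classical all_reals all_analysis.

(** Let [N] be the image of [f_*] in [pi0 G]. It is the subgroup generated by
    the components of the elements [f h], [h] in [H], because the components
    of [H] generate [hatpi0 H]. Moving along an orbit multiplies the
    [G]-coordinate on the right by some [f h], so the coset of the component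
    of that coordinate modulo [N] is an invariant of points of [G_Q/H]; both
    directions compare it with connectedness.

    If [G_Q/H] is connected, the points where the invariant is the trivial
    coset form a clopen subset (components of [G] are open, as [G] is locally
    path connected), which is nonempty as [Q] is, hence is everything; so [N]
    is the whole of [pi0 G] ([ubiquitous_hatpi0_map_surj]).

    Conversely, the points [(x, p)] and [(y, q)] of [G_Q] have classes in the
    same connected component of [G_Q/H] when [x] and [y] are in the same
    component of [G], since [Q] is connected; and multiplying [x] by [f h]
    over the base point of [h] does not change the class. As [p] can be moved
    freely, components of [G] which differ by an element of [N] are therefore
    joined in [G_Q/H] ([joined_hatpi0_map]). If [N] is [pi0 G], all points are
    joined. *)

Set Implicit Arguments.
Unset Strict Implicit.
Unset Printing Implicit Defensive.

Local Open Scope classical_set_scope.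
Local Open Scope quotient_scope.

Lemma connected_setT_component (X : topologicalType) (x : X) :
  (forall y, connected_component [set: X] x y) -> connected [set: X].
Proof.
move=> xy; have <- : connected_component [set: X] x = setT.
  by apply/seteqP; split.
exact: component_connected.
Qed.

Lemma connected_component_prod (X Y : topologicalType) (x x' : X) (y y' : Y) :
  connected_component [set: X] x x' -> connected_component [set: Y] y y' ->
  connected_component [set: X * Y] (x, y) (x', y').
Proof.
move=> xx' yy'; apply: (connected_component_trans (y := (x', y))).
  apply: (connected_component_image (g := fun a => (a, y))) => //.
  by move=> a; apply: cvg_pair => //; exact: cvg_cst.
apply: (connected_component_image (g := fun b => (x', b))) => //.
by move=> b; apply: cvg_pair => //; exact: cvg_cst.
Qed.

Section ubiquity_theory.
Variables (R : realType) (Q : topologicalType).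
Variables (hQ : hausdorff_space Q) (lQ : locally_path_connected R Q).
Variables (G : lieGroup R) (H : qgroup R Q).
Variable f : qmorphism H (lie_qgroup hQ lQ G).

Definition orbit_class (y : G * Q) : orbit_space f :=
  \pi_{eq_quot orbit_eqv f} (y : lie_qgroup hQ lQ G).

Lemma orbit_class_continuous : continuous orbit_class.
Proof. exact: pi_continuous. Qed.

Lemma orbit_classP (y z : G * Q) :
  orbit_class y = orbit_class z <-> orbit_rel f y z.
Proof.
split=> [yz|yz].
  have /eqP : \pi_{eq_quot orbit_eqv f} y = \pi_{eq_quot orbit_eqv f} z by [].
  by rewrite eqmodE => /asboolP.
suff : \pi_{eq_quot orbit_eqv f} y = \pi_{eq_quot orbit_eqv f} z by [].
by apply/eqP; rewrite eqmodE; apply/asboolP.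
Qed.

Lemma orbit_class_repr (c : orbit_space f) : orbit_class (repr c) = c.
Proof. exact: reprK. Qed.

Definition hatpi0_image : set (pi0 G) :=
  [set c | exists w : hatpi0 H, hatpi0_map f w = c].

(** The coset of the component modulo the image of [f_*] is constant along
    orbits: passing from [y] to [y * f h] multiplies the component of [y] by
    the image under [f_*] of the generator given by the component of [h]. *)
Lemma hatpi0_image_orbit (y z : G * Q) : orbit_rel f y z ->
  hatpi0_image (component y.1) -> hatpi0_image (component z.1).
Proof.
move=> /orbit_relE[h [_ _ ->]] [w wE].
exists (w * generator _ (component h))%g.
by rewrite gmulfM wE hatpi0_mapE componentM.
Qed.

(** The points of [G_Q/H] whose invariant is the trivial coset; by
    [image_pointsE] the choice of a representative is immaterial. *)
Definition image_points : set (orbit_space f) :=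
  [set c | hatpi0_image (component (repr c : G * Q).1)].

Lemma image_pointsE (y : G * Q) :
  image_points (orbit_class y) <-> hatpi0_image (component y.1).
Proof.
have yr : orbit_rel f (repr (orbit_class y)) y.
  by apply/orbit_classP; exact: orbit_class_repr.
have ry : orbit_rel f y (repr (orbit_class y)).
  by apply/orbit_classP/esym; exact: orbit_class_repr.
by split; exact: hatpi0_image_orbit.
Qed.

Lemma component_fst_continuous :
  continuous (fun y : G * Q => component y.1 : pi0 G).
Proof.
move=> y; apply: (continuous_comp (f := fst)); first exact: cvg_fst.
exact: (component_continuous (@lie_lpc R G)).
Qed.

(** Openness in [G_Q/H] is tested in [G_Q]. There the set and its complement
    both depend only on the component of the [G]-coordinate, which is a
    continuous function to a discrete space. *)
Lemma image_points_clopen : clopen image_points.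
Proof.
have oP (B : set (orbit_space f)) (P : set (pi0 G)) :
    (forall y, B (orbit_class y) <-> P (component y.1)) -> open B.
  move=> BP; suff : open (orbit_class @^-1` B) by [].
  have -> : orbit_class @^-1` B = (fun y : G * Q => component y.1) @^-1` P.
    by apply/seteqP; split=> y /BP.
  by move/continuousP: component_fst_continuous; apply; exact: discrete_open.
split; first exact: oP image_pointsE.
rewrite -openC; apply: (oP _ (~` hatpi0_image)) => y.
by split; apply: contra_not => /image_pointsE.
Qed.

Lemma ubiquitous_hatpi0_map_surj : [set: Q] !=set0 -> ubiquitous f ->
  hatpi0_image = setT.
Proof.
move=> [q _] cf; have [oN cN] := image_points_clopen.
have NT : image_points = setT.
  apply: cf; [|by exists image_points; rewrite ?setTI..].
  by exists (orbit_class (1%g, q)); apply/image_pointsE; exists 1%g; rewrite gmulf1.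
apply/seteqP; split=> // c _; rewrite -[c]component_repr.
by apply/(image_pointsE (repr c, q)); rewrite NT.
Qed.

Definition joined (y z : G * Q) :=
  connected_component [set: orbit_space f] (orbit_class y) (orbit_class z).

Hypothesis cQ : connected [set: Q].

(** This is where connectedness of [Q] enters: the base point can be moved
    arbitrarily. *)
Lemma joined_component (x y : G) (p q : Q) :
  component x = component y -> joined (x, p) (y, q).
Proof.
move=> /componentP xy.
apply: (connected_component_image orbit_class_continuous).
apply: connected_component_prod => //.
by exists setT.
Qed.

(** The orbit relation joins the two points over the base point of [h]; they
    are first moved there, and then away to any other base point. *)
Lemma joined_orbit (x : G) (h : H) (p q : Q) : joined (x, p) ((x * (f h).1)%g, q).
Proof.
apply: (connected_component_trans (y := orbit_class (x, qnorm h))).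
  exact: joined_component.
have -> : orbit_class (x, qnorm h) = orbit_class ((x * (f h).1)%g, qnorm h).
  by apply/orbit_classP/orbit_relE; exists h.
exact: joined_component.
Qed.

(** A word in the components of [H] is followed letter by letter. Consecutive
    letters may live over different points of [Q], so that their product need
    not make sense in [H]; this is harmless since [joined_orbit] allows any
    change of base point between two steps. *)
Lemma joined_hatpi0_map (w : hatpi0 H) (x y : G) (p q : Q) :
  component y = (component x * hatpi0_map f w)%g -> joined (x, p) (y, q).
Proof.
rewrite -[w]pres_class_repr; elim: (repr w) x p => [|[c b] v IH] x p.
  rewrite gmulf1 mulg1 => /esym; exact: joined_component.
have -> : pres_class (@hatpi0_rel _ _ H) ((c, b) :: v) =
    (pres_class (@hatpi0_rel _ _ H) [:: (c, b)] * pres_class (@hatpi0_rel _ _ H) v)%g.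
  by rewrite [RHS]pres_mulE.
rewrite gmulfM mulgA -[c]component_repr; set h := repr c.
have fh : hatpi0_map f (pres_class _ [:: (component h, b)]) =
    component (f (if b then qinv h else h)).1.
  (* An inverse letter acts through the fibrewise inverse of [h]. *)
  case: b; last exact: hatpi0_mapE.
  have -> : pres_class _ [:: (component h, true)] =
      (generator (@hatpi0_rel _ _ H) (component h))^-1%g.
    by rewrite [RHS]pres_invE.
  by rewrite gmulfV hatpi0_mapE Defs.finv; exact: pi0_invE.
rewrite fh -componentM => yE.
exact: connected_component_trans (joined_orbit _ _ _ p) (IH _ _ yE).
Qed.

End ubiquity_theory.

Theorem proposition1p10 (R : realType) (Q : topologicalType)
    (hQ : hausdorff_space Q) (Q0 : [set: Q] !=set0) (cQ : connected [set: Q])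
    (lQ : locally_path_connected R Q)
    (G : lieGroup R) (H : qgroup R Q) (f : qmorphism H (lie_qgroup hQ lQ G)) :
  ubiquitous f <->
  (forall c : pi0 G, exists w : hatpi0 H, hatpi0_map f w = c).
Proof.
split=> [uf c|fsurj].
  suff : hatpi0_image f c by [].
  by rewrite (ubiquitous_hatpi0_map_surj Q0 uf).
have [q _] := Q0.
apply: (connected_setT_component (x := orbit_class f (1%g, q))) => c.
rewrite -[c]orbit_class_repr; case: (repr c) => y p.
have [w wE] := fsurj (component y).
apply: (joined_hatpi0_map cQ (w := w)).
by rewrite wE -componentM mul1g.
Qed.
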